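(* Let $\nu={\stackrel{*}{\nu}}+\widetilde\nu\,i$ (${\stackrel{*}{\nu}}={\rm Re}\,\nu$, $\widetilde\nu={\rm Im}\,\nu$) be an eigenvector of the matrix $B$ corresponding to the complex eigenvalue $\lambda={\stackrel{*}{\lambda}}+\widetilde\lambda\,i$ (${\stackrel{*}{\lambda}}={\rm Re}\,\lambda$, $\widetilde\lambda={\rm Im}\,\lambda\ne0$). Then the system of ordinary differential equations $\dfrac{dx}{dt}=Ax$ has the autonomous first integral $$F\colon x\to\bigl(({\stackrel{*}{\nu}}x)^2+(\widetilde\nu x)^2\bigr)\exp\Bigl(-2\,\frac{{\stackrel{*}{\lambda}}}{\widetilde\lambda}\arctan\frac{\widetilde\nu x}{{\stackrel{*}{\nu}}x}\Bigr)\quad\text{for all }x\in\mathscr X,$$ where $\mathscr X\subset\{x\colon{\stackrel{*}{\nu}}x\ne0\}$ is a domain.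
   Context: $A$ is a real $n\times n$ matrix, $x\in\mathbb R^n$, and $B=A^T$. For a vector $\nu$, $\nu x=\sum_{i=1}^n\nu_ix_i$. A continuously differentiable function $F$ on a domain $\mathscr X\subset\mathbb R^n$ is an autonomous first integral of $dx/dt=Ax$ if $\sum_{i=1}^n(Ax)_i\,\partial_{x_i}F(x)=0$ on $\mathscr X$. *)

(* Defs.v *)
From HB Require Import structures.
From mathcomp Require Import all_boot all_order all_algebra.
From mathcomp Require Import all_classical all_reals all_analysis.
From mathcomp Require Import complex.

Set Implicit Arguments.
Unset Strict Implicit.
Unset Printing Implicit Defensive.

Import Order.TTheory GRing.Theory Num.Theory.
Import numFieldNormedType.Exports.

Local Open Scope classical_set_scope.
Local Open Scope ring_scope.

Definition eigenvector (C : fieldType) n (B : 'M[C]_n) (lambda : C)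
    (v : 'cV[C]_n) : Prop :=
  v != 0 /\ B *m v = lambda *: v.

Definition re_vec (R : realType) n (v : 'cV[R[i]]_n) : 'cV[R]_n :=
  \col_k complex.Re (v k ord0).

Definition im_vec (R : realType) n (v : 'cV[R[i]]_n) : 'cV[R]_n :=
  \col_k complex.Im (v k ord0).

Definition pairing (R : realType) n (v x : 'cV[R]_n) : R :=
  \sum_k v k ord0 * x k ord0.

Definition domain (T : topologicalType) (X : set T) : Prop :=
  [/\ X !=set0, open X & connected X].

Definition partial (R : realType) n (F : 'cV[R]_n -> R) (k : 'I_n) :
    'cV[R]_n -> R :=
  fun x => 'D_(delta_mx k ord0) F x.

(* The values of [F] outside the open set [X] are irrelevant: differentiability
   and continuity at a point of [X] only depend on [F] near that point. *)
Definition continuously_differentiable_on (R : realType) n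
    (X : set 'cV[R]_n) (F : 'cV[R]_n -> R) : Prop :=
  forall x, X x ->
    differentiable F x /\ forall k, {for x, continuous (partial F k)}.

Definition autonomous_first_integral (R : realType) n (A : 'M[R]_n)
    (X : set 'cV[R]_n) (F : 'cV[R]_n -> R) : Prop :=
  continuously_differentiable_on X F /\
  forall x, X x -> \sum_k (A *m x) k ord0 * partial F k x = 0.

(* Main.v *)
From HB Require Import structures.
Require Import Defs.
From mathcomp Require Import all_boot all_order all_algebra.
From mathcomp Require Import all_classical all_reals all_analysis.
From mathcomp Require Import complex.
From mathcomp Require Import ring.

Set Implicit Arguments.
Unset Strict Implicit.
Unset Printing Implicit Defensive.

Import Order.TTheory GRing.Theory Num.Theory.
Import numFieldNormedType.Exports.

Local Open Scope classical_set_scope.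
Local Open Scope ring_scope.

(** Let [p] and [q] be the linear forms given by the real and imaginary parts
    of [nu], and [l], [m] the real and imaginary parts of [lambda]. Since [nu]
    is an eigenvector of the transpose of [A], the complex coordinate
    [z = p + i q] satisfies [z' = lambda z] along every solution. Where [z]
    is not zero, in polar coordinates, this says that [log r] grows at the constant
    rate [l] and the angle [theta] at the constant rate [m]. Hence
    [log (r ^+ 2) - 2 (l / m) theta] is conserved, and [F] is its exponential,
    with [theta] computed as [atan (q / p)] where [p != 0].

    The proof carries this out by differentiating: [is_diff_spiral_integral]
    computes the differential of [F], from which [spiral_integral_C1] gives
    continuous differentiability, and [spiral_diff_flow] checks that it
    annihilates the vector field [A x], using the real and imaginary parts
    of the eigenvector equation, [eigenvector_re_im]. *)

(** Rewrites the sum of partial derivatives in the definition of a first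
    integral as one directional derivative: the differential is linear and
    [v] is the combination of the basis vectors with its own coordinates. *)
Lemma sum_partial (R : realType) n (F : 'cV[R]_n -> R) (x v : 'cV[R]_n) :
  differentiable F x -> \sum_k v k ord0 * partial F k x = 'D_v F x.
Proof.
move=> dF; rewrite deriveE // {2}[v]matrix_sum_delta linear_sum.
by apply: eq_bigr => k _; rewrite big_ord1 linearZ /partial deriveE.
Qed.

Lemma pairing_is_linear (R : realType) n (a : 'cV[R]_n) :
  linear (pairing a : 'cV[R]_n -> R).
Proof.
move=> k u v; rewrite /pairing scaler_sumr -big_split /=.
by apply: eq_bigr => i _; rewrite !mxE mulrDr mulrCA.
Qed.

HB.instance Definition _ (R : realType) n (a : 'cV[R]_n) :=
  GRing.isLinear.Build _ _ _ _ (pairing a) (pairing_is_linear a).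

Lemma pairing_mulmx (R : realType) n (A : 'M[R]_n) (a x : 'cV[R]_n) :
  pairing a (A *m x) = pairing (A^T *m a) x.
Proof.
have pairingE (u v : 'cV[R]_n) : pairing u v = (u^T *m v) ord0 ord0.
  by rewrite mxE; apply: eq_bigr => i _; rewrite mxE.
by rewrite !pairingE trmx_mul trmxK mulmxA.
Qed.

Lemma pairing_continuous (R : realType) n (a : 'cV[R]_n) :
  continuous (pairing a).
Proof.
apply: continuous_big => [u|k _ x]; first exact: add_continuous.
exact: cvgMl_tmp (@coord_continuous R n 1 k ord0 x).
Qed.

Lemma is_diff_pairing (R : realType) n (a x : 'cV[R]_n) :
  is_diff x (pairing a) (pairing a).
Proof.
pose f : {linear 'cV[R]_n -> R} := pairing a.
have fc : continuous f := @pairing_continuous R n a.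
have f_diff := linear_differentiable x fc; have f_diffE := diff_lin x fc.
exact: DiffDef.
Qed.

(** The chain rule in a form that keeps the derivative of the outer function
    as a number, so that the results of one-variable calculus on [expR],
    [atan] and inversion compose with functions of a vector. *)
Lemma is_diff_scalar_comp (R : realType) (V : normedModType R)
    (f df : V -> R) (g : R -> R) (g' : R) (x : V) :
  is_diff x f df -> is_derive (f x) 1 g g' ->
  is_diff x (g \o f) (fun v => g' * df v).
Proof.
move=> fx [gd ge]; have gx : differentiable g (f x) by apply/derivable1_diffP.
have gdiff : is_diff (f x) g (fun h => g' * h).
  apply: DiffDef => //; rewrite diff1E // funeqE => h.
  by rewrite derive1E ge [LHS]mulrC.
exact: is_diff_comp.
Qed.

(** Separating real and imaginary parts of [B v = lambda v]; this uses that
    [B] is real, so that [B] commutes with taking either part. *)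
Lemma eigenvector_re_im (R : realType) n (B : 'M[R]_n) (v : 'cV[R[i]]_n)
    (lambda : R[i]) :
  map_mx (real_complex R) B *m v = lambda *: v ->
  B *m re_vec v = complex.Re lambda *: re_vec v
                  - complex.Im lambda *: im_vec v /\
  B *m im_vec v = complex.Re lambda *: im_vec v
                  + complex.Im lambda *: re_vec v.
Proof.
move=> Bv.
have Bvk k : \sum_j ((B k j)%:C%C * v j ord0) = lambda * v k ord0.
  move/matrixP: Bv => /(_ k ord0); rewrite !mxE => <-.
  by apply: eq_bigr => j _; rewrite mxE.
split; apply/colP => k; rewrite !mxE.
  transitivity (complex.Re (\sum_j ((B k j)%:C%C * v j ord0))).
    rewrite raddf_sum; apply: eq_bigr => j _.
    by rewrite !mxE; case: (v j ord0) => a b /=; rewrite mul0r subr0.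
  by rewrite Bvk; case: lambda (v k ord0) {Bv Bvk} => l m [a b].
transitivity (complex.Im (\sum_j ((B k j)%:C%C * v j ord0))).
  rewrite raddf_sum; apply: eq_bigr => j _.
  by rewrite !mxE; case: (v j ord0) => a b /=; rewrite mul0r addr0.
by rewrite Bvk; case: lambda (v k ord0) {Bv Bvk} => l m [a b].
Qed.

(** On the half-spaces where [pairing a x] keeps its sign, the arctangent
    differs by a constant from the polar angle of the point with coordinates
    [pairing a x] and [pairing b x]; hence this is, up to a factor, the
    exponential of [c] times that angle. *)
Definition exp_angle (R : realType) n (c : R) (a b x : 'cV[R]_n) : R :=
  expR (c * atan (pairing b x / pairing a x)).

(** In the polar coordinates [r], [theta] of the plane of the two linear forms,
    this is [r ^+ 2] times [expR (c * theta)] up to a factor; its level sets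
    where [pairing a x != 0] are made of arcs of logarithmic spirals, or of
    circles when [c] is zero. *)
Definition spiral_integral (R : realType) n (c : R) (a b x : 'cV[R]_n) : R :=
  (pairing a x ^+ 2 + pairing b x ^+ 2) * exp_angle c a b x.

(** The differential of [spiral_integral c a b] at a point [x] such that
    [pairing a x != 0], applied to [v]. The squared radius has cancelled
    against the denominator of the derivative of the angle, so the formula is
    continuous in [x] as soon as [exp_angle] is. *)
Definition spiral_diff (R : realType) n (c : R) (a b x v : 'cV[R]_n) : R :=
  exp_angle c a b x * ((2 * pairing a x - c * pairing b x) * pairing a v +
                       (2 * pairing b x + c * pairing a x) * pairing b v).

Lemma sqrD_neq0 (R : realType) (p q : R) : p != 0 -> p ^+ 2 + q ^+ 2 != 0.
Proof. by move=> p0; rewrite gt_eqF // ltr_wpDr ?sqr_ge0 // exprn_even_gt0. Qed.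

(** The differential of the polar angle of [(p, q)] is
    [(p dq - q dp) / (p ^+ 2 + q ^+ 2)]; here it comes out of the derivative
    of [atan] at [q / p], whence [pairing a x != 0]. *)
Lemma is_diff_exp_angle (R : realType) n (c : R) (a b x : 'cV[R]_n) :
  pairing a x != 0 ->
  is_diff x (exp_angle c a b)
    (fun v => exp_angle c a b x *
      (c * ((pairing a x * pairing b v - pairing b x * pairing a v) /
            (pairing a x ^+ 2 + pairing b x ^+ 2)))).
Proof.
move=> a0.
have da := is_diff_pairing a x; have db := is_diff_pairing b x.
have dV : is_diff x (GRing.inv \o pairing a)
    (fun v => - (pairing a x) ^- 2 * pairing a v).
  apply: is_diff_scalar_comp; apply: DeriveDef.
    by apply/derivable1_diffP/differentiable_Rinv.
  rewrite deriveE; last exact: differentiable_Rinv.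
  by rewrite diff_Rinv //= [LHS]mulr1.
have dq := is_diffM db dV.
have dat := is_diff_scalar_comp dq (is_derive1_atan _).
have dz := is_diffZ c dat.
have dE := is_diff_scalar_comp dz (is_derive_expR _).
apply: (@is_diff_eq _ _ _ _ _ _ _ dE); apply/funext => v.
rewrite /exp_angle !fctE /=.
have n0 := sqrD_neq0 (pairing b x) a0.
rewrite /GRing.scale /=; congr (_ * (_ * _)).
by field; rewrite n0 a0.
Qed.

Lemma is_diff_spiral_integral (R : realType) n (c : R) (a b x : 'cV[R]_n) :
  pairing a x != 0 ->
  is_diff x (spiral_integral c a b) (spiral_diff c a b x).
Proof.
move=> a0.
have da := is_diff_pairing a x; have db := is_diff_pairing b x.
(* The exponent 1 denotes the square: [is_diffX k] differentiates the power
   [k.+1]. *)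
have dF := is_diffM (is_diffD (is_diffX 1 da) (is_diffX 1 db))
  (is_diff_exp_angle c b a0).
have -> : spiral_integral c a b =
    (pairing a ^+ 2 + pairing b ^+ 2) * exp_angle c a b.
  by apply/funext.
apply: (@is_diff_eq _ _ _ _ _ _ _ dF); apply/funext => v.
have n0 := sqrD_neq0 (pairing b x) a0.
rewrite /spiral_diff !fctE /= /GRing.scale /=.
by field.
Qed.

Lemma derive_spiral_integral (R : realType) n (c : R) (a b x v : 'cV[R]_n) :
  pairing a x != 0 ->
  'D_v (spiral_integral c a b) x = spiral_diff c a b x v.
Proof.
by move=> /(is_diff_spiral_integral c b) dF; rewrite deriveE // diff_val.
Qed.

Lemma spiral_diff_continuous (R : realType) n (c : R) (a b x v : 'cV[R]_n) :
  pairing a x != 0 ->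
  spiral_diff c a b y v @[y --> x] --> spiral_diff c a b x v.
Proof.
move=> a0.
have ca := @pairing_continuous R n a x; have cb := @pairing_continuous R n b x.
have cE : {for x, continuous (exp_angle c a b)}.
  by have [dE _] := is_diff_exp_angle c b a0; exact: differentiable_continuous.
exact: cvgM cE (cvgD (cvgMr_tmp (cvgB (cvgMl_tmp ca) (cvgMl_tmp cb)))
  (cvgMr_tmp (cvgD (cvgMl_tmp cb) (cvgMl_tmp ca)))).
Qed.

(** The formula for the partial derivatives holds on the open set where
    [pairing a] does not vanish, that is on a neighborhood of each point of
    [X], so their continuity at the point is that of the formula. *)
Lemma spiral_integral_C1 (R : realType) n (c : R) (a b : 'cV[R]_n)
    (X : set 'cV[R]_n) :
  X `<=` [set x | pairing a x != 0] ->
  continuously_differentiable_on X (spiral_integral c a b).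
Proof.
move=> X0 x /X0 /= a0; split; first by case: (is_diff_spiral_integral c b a0).
move=> k.
have partialE y : pairing a y != 0 ->
    partial (spiral_integral c a b) k y = spiral_diff c a b y (delta_mx k ord0).
  exact: derive_spiral_integral.
have near_partialE : {near x,
    (fun y => spiral_diff c a b y (delta_mx k ord0)) =1
    partial (spiral_integral c a b) k}.
  have near0 : nbhs x (fun y => pairing a y != 0).
    exact: cvgr_neq0 (@pairing_continuous R n a x) a0.
  by apply: (filterS _ near0) => y y0; rewrite partialE.
have := spiral_diff_continuous (c := c) (b := b) (v := delta_mx k ord0) a0.
rewrite -partialE //.
exact: cvg_trans (near_eq_cvg near_partialE).
Qed.

(** Along the flow the two forms [p] and [q] obey [p' = l p - m q] and
    [q' = l q + m p]: the squared radius grows at rate [2 l] and the angle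
    turns at rate [m], so the logarithmic derivative of [spiral_integral c]
    is [2 l + c m], and [c = - 2 l / m] is the value that makes it vanish. *)
Lemma spiral_diff_flow (R : realType) n (l m : R) (A : 'M[R]_n)
    (a b x : 'cV[R]_n) :
  m != 0 -> A^T *m a = l *: a - m *: b -> A^T *m b = l *: b + m *: a ->
  spiral_diff (- 2 * (l / m)) a b x (A *m x) = 0.
Proof.
move=> m0 Aa Ab.
have pa : pairing a (A *m x) = l * pairing a x - m * pairing b x.
  rewrite pairing_mulmx Aa /pairing !mulr_sumr -sumrB.
  by apply: eq_bigr => i _; rewrite !mxE; ring.
have pb : pairing b (A *m x) = l * pairing b x + m * pairing a x.
  rewrite pairing_mulmx Ab /pairing !mulr_sumr -big_split /=.
  by apply: eq_bigr => i _; rewrite !mxE; ring.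
by rewrite /spiral_diff pa pb; field.
Qed.

Theorem theorem3p3 (R : realType) (n : nat) (A : 'M[R]_n)
    (nu : 'cV[R[i]]_n) (lambda : R[i])
    (Hnu : eigenvector (map_mx (real_complex R) A^T) lambda nu)
    (Hlambda : complex.Im lambda != 0)
    (X : set 'cV[R]_n) (HX : domain X)
    (HX0 : X `<=` [set x | pairing (re_vec nu) x != 0]) :
  autonomous_first_integral A X (fun x =>
    (pairing (re_vec nu) x ^+ 2 + pairing (im_vec nu) x ^+ 2) *
    expR (- 2 * (complex.Re lambda / complex.Im lambda) *
          atan (pairing (im_vec nu) x / pairing (re_vec nu) x))).
Proof.
have [_ /eigenvector_re_im [Are Aim]] := Hnu.
split; first exact: spiral_integral_C1.
move=> x /HX0 /= a0.
have [dF _] := is_diff_spiral_integral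
  (- 2 * (complex.Re lambda / complex.Im lambda)) (im_vec nu) a0.
rewrite [LHS](sum_partial _ dF) derive_spiral_integral //.
exact: spiral_diff_flow.
Qed.
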